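(* Let $\mathcal M$ be the set of monotone Möbius structures on $X=S^1$. For $q=(o,\omega,v,\omega',o',u,x)\in\mathrm{reg}^+\mathcal P_7$ put $$\varepsilon(q)=\frac{|o\omega|_0^2}{4|x\omega'|_0^2},$$ where $|\cdot\,\cdot|_0$ is a metric from the canonical Möbius structure $M_0$ with infinitely remote point $u$ (the value is independent of its choice). Let $$V=\{(q,r)\in\mathrm{reg}^+\mathcal P_7\times\mathbb R^4:\ |r-R_{M_0}(q)|<\varepsilon(q)\},\qquad U_V=\{M\in\mathcal M:\ (q,R_M(q))\in V\ \text{for all}\ q\in\mathrm{reg}^+\mathcal P_7\}.$$ Then every Möbius structure $M\in U_V$ satisfies the Increment Axiom (I).
   Context: **Möbius structures.** $X=S^1$. A semi-metric on $X$ is a symmetric function $d:X^2\to\mathbb R\cup\{\infty\}$, positive off the diagonal, zero on it, with at most one infinitely remote point $\omega_0$, i.e. a point with $d(x,\omega_0)=\infty$ for some (then, by requirement, for all) $x\ne\omega_0$. Two semi-metrics are Möbius equivalent if they have the same cross-ratios $\frac{d(x_1,x_3)d(x_2,x_4)}{d(x_1,x_4)d(x_2,x_3)}$ on all 4-tuples of pairwise distinct points; here and in all homogeneous expressions below infinite distances cancel. A Möbius structure $M$ is a Möbius equivalence class of semi-metrics. The $M$-topology has as subbase all open balls, centered at finite points, of semi-metrics in $M$ having an infinitely remote point. Two disjoint pairs of points separate each other if the points of one lie in different components of the complement of the other. $M$ is monotone if (T) the $M$-topology is the usual topology of $S^1$, and (M) whenever $(x,y)$, $(z,u)$ separate each other,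 $|xy|\,|zu|>\max\{|xz|\,|yu|,|xu|\,|yz|\}$ for any semi-metric from $M$. The canonical Möbius structure $M_0$ on $S^1=\mathbb R\cup\{\infty\}$ is the class of the standard metric of $\mathbb R$ extended by $|x\infty|=\infty$. **Notation.** $\mathrm{reg}^+\mathcal P_7$ is the set of 7-tuples of pairwise distinct points of $X$ listed in cyclic order along the circle (in one of the two directions), with the topology induced from $X^7$. For a Möbius structure $M$, a semi-metric $|\cdot\,\cdot|$ from $M$, and $q=(o,\omega,v,\omega',o',u,x)\in\mathrm{reg}^+\mathcal P_7$, $$R_M(q)=\left(\frac{|ou|\,|vo'|}{|ov|\,|o'u|},\ \frac{|\omega u|\,|v\omega'|}{|\omega v|\,|\omega'u|},\ \frac{|ou|\,|\omega x|}{|ox|\,|\omega u|},\ \frac{|\omega'u|\,|o'x|}{|\omega'x|\,|o'u|}\right)\in\mathbb R^4,$$ and $|\cdot|$ on $\mathbb R^4$ is the Euclidean norm. **Increment Axiom (I)** for $M$: for every $q\in\mathrm{reg}^+\mathcal P_7$ such that the first two coordinates of $R_M(q)$ are both equal to $1$, the third coordinate of $R_M(q)$ is strictly greater than the fourth. (The sets $\{M\in\mathcal M:(q,R_M(q))\in W\ \forall q\}$, $W\subset\mathrm{reg}^+\mathcal P_7\times\mathbb R^4$ open, form a base of the so-called fine topology on $\mathcal M$.) *)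

(* Defs.v *)
From HB Require Import structures.
From mathcomp Require Import all_boot all_order all_algebra.
From mathcomp Require Import all_classical all_reals all_analysis.
From mathcomp Require Import ring lra.

Set Implicit Arguments.
Unset Strict Implicit.
Unset Printing Implicit Defensive.

Import Order.TTheory GRing.Theory Num.Theory.
Import numFieldNormedType.Exports.

Local Open Scope classical_set_scope.
Local Open Scope ring_scope.

Section MobiusStructures.
Variable R : realType.

(* S^1 = R \cup {oo}: [Some a] is the real point a, [None] is oo.  The library
   equips this type with the topology of the one-point compactification. *)
Definition circle := one_point_compactification R.

Implicit Types (d : circle -> circle -> \bar R) (x y z w : circle).

Definition remote d w := forall x, x <> w -> d x w = +oo%E.

(* By symmetry, an infinite distance d x y makes only one of x, y infinitely
   remote: this is the reading of the last two clauses. *)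
Definition semimetric d :=
  [/\ forall x y, d x y = d y x,
      forall x, d x x = 0%E,
      forall x y, x <> y -> (0 < d x y)%E,
      forall x y, d x y = +oo%E -> remote d x \/ remote d y &
      forall w w', remote d w -> remote d w' -> w = w'].

(* In the homogeneous expressions below each point occurs equally often in
   every product, so that reading each infinite distance as 1 is exactly the
   cancellation of infinite distances. *)
Definition fdist d x y : R := if d x y is r%:E then r else 1.

Definition cross_ratio d x1 x2 x3 x4 : R :=
  (fdist d x1 x3 * fdist d x2 x4) / (fdist d x1 x4 * fdist d x2 x3).

Definition mobius_equiv d d' :=
  forall x1 x2 x3 x4, uniq [:: x1; x2; x3; x4] ->
    cross_ratio d x1 x2 x3 x4 = cross_ratio d' x1 x2 x3 x4.

Definition mobius_class d : set (circle -> circle -> \bar R) :=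
  [set d' | semimetric d' /\ mobius_equiv d d'].

Record mobius_structure := MobiusStructure {
  semimetrics : set (circle -> circle -> \bar R);
  semimetricsP : exists2 d, semimetric d & semimetrics = mobius_class d }.

Implicit Types M : mobius_structure.

Definition mobius_balls M : set (set circle) :=
  [set B | exists d c (r : R), [/\ semimetrics M d, exists w, remote d w, ~ remote d c,
    0 < r & B = [set y | (d c y < r%:E)%E]]].

(* arbitrary unions of finite intersections of elements of the subbase *)
Definition mobius_open M : set (set circle) :=
  [set \bigcup_(B in D) B | D in subset^~ (finI_from (mobius_balls M) id)].

Definition separate x y z w :=
  uniq [:: x; y; z; w] /\
  connected_component (~` [set x; y]) z <> connected_component (~` [set x; y]) w.

Definition monotone_mobius M :=
  mobius_open M = [set A : set circle | open A] /\
  forall d x y z w, semimetrics M d -> separate x y z w ->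
    Num.max (fdist d x z * fdist d y w) (fdist d x w * fdist d y z)
      < fdist d x y * fdist d z w.

Definition std_dist : circle -> circle -> \bar R := fun x y =>
  match x, y with
  | Some a, Some b => (`|a - b|)%:E
  | None, None => 0%E
  | _, _ => +oo%E
  end.

Lemma std_distC x y : std_dist x y = std_dist y x.
Proof. by case: x y => [a|] [b|] //=; rewrite distrC. Qed.

Lemma std_dist_triangle x y z :
  (std_dist x z <= std_dist x y + std_dist y z)%E.
Proof.
case: x y z => [a|] [b|] [c|] //=; rewrite ?addye ?addey ?leey ?adde0 //.
by rewrite -EFinD lee_fin ler_distD.
Qed.

Lemma std_dist_remote : remote std_dist None.
Proof. by case. Qed.

Lemma std_dist_remoteE w : remote std_dist w -> w = None.
Proof.
case: w => [a|//] rw; have /rw : Some (a + 1) <> Some a; last by [].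
by move=> [] /eqP; rewrite -subr_eq0 addrAC subrr add0r oner_eq0.
Qed.

Lemma std_dist_semimetric : semimetric std_dist.
Proof.
split; first exact: std_distC.
- by case=> [a|] //=; rewrite subrr normr0.
- case=> [a|] [b|] //= ab; rewrite ?ltry // lte_fin normr_gt0 subr_eq0.
  by apply/eqP => e; apply: ab; rewrite e.
- by case=> [a|] [b|] //= _; [right|left]; exact: std_dist_remote.
- by move=> w w' /std_dist_remoteE -> /std_dist_remoteE ->.
Qed.

Lemma mobius_structure0_subproof :
  exists2 d, semimetric d & mobius_class std_dist = mobius_class d.
Proof. by exists std_dist => //; exact: std_dist_semimetric. Qed.

Definition mobius_structure0 := MobiusStructure mobius_structure0_subproof.

Definition septuple : Type :=
  circle * circle * circle * circle * circle * circle * circle.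

Definition points (q : septuple) : seq circle :=
  let '(o, w, v, w', o', u, x) := q in [:: o; w; v; w'; o'; u; x].

(* the circle cut at oo, with oo as largest point *)
Definition cut_lt x y : bool :=
  let pos p := if p is Some a then a%:E else +oo%E in (pos x < pos y)%E.

Definition cyclically_ordered (s : seq circle) :=
  exists k, sorted cut_lt (rot k s).

Definition regp7 : set septuple :=
  [set q | uniq (points q) /\
     (cyclically_ordered (points q) \/ cyclically_ordered (rev (points q)))].

Definition incr_row d (q : septuple) : 'rV[R]_4 :=
  let '(o, w, v, w', o', u, x) := q in
  \row_i [:: (fdist d o u * fdist d v o') / (fdist d o v * fdist d o' u);
             (fdist d w u * fdist d v w') / (fdist d w v * fdist d w' u);
             (fdist d o u * fdist d w x) / (fdist d o x * fdist d w u);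
             (fdist d w' u * fdist d o' x) / (fdist d w' x * fdist d o' u)]`_i.

(* computed with an arbitrary semi-metric of M, cf. [R_ME] *)
Definition R_M M (q : septuple) : 'rV[R]_4 := incr_row (xget std_dist (semimetrics M)) q.

Lemma semimetrics_equiv M d d' :
  semimetrics M d -> semimetrics M d' -> mobius_equiv d d'.
Proof.
have [d1 _ ->] := semimetricsP M; move=> -[_ e] [_ e'] x1 x2 x3 x4 Hx.
by rewrite -e // e'.
Qed.

Lemma semimetrics_neq0 M : exists d, semimetrics M d.
Proof. by have [d sd ->] := semimetricsP M; exists d; split. Qed.

Lemma semimetrics_semimetric M d : semimetrics M d -> semimetric d.
Proof. by have [d1 _ ->] := semimetricsP M; case. Qed.

Lemma fdistC d x y : semimetric d -> fdist d x y = fdist d y x.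
Proof. by case=> dC _ _ _ _; rewrite /fdist dC. Qed.

Lemma fdist_gt0 d x y : semimetric d -> x <> y -> 0 < fdist d x y.
Proof.
case=> _ _ d0 _ _ /d0; rewrite /fdist.
by case: (d x y) => [r||] //; rewrite lte_fin.
Qed.

Lemma fdist_remote d w x : remote d w -> x <> w -> fdist d x w = 1.
Proof. by move=> rw xw; rewrite /fdist rw. Qed.

Lemma incr_row_cross_ratio d o w v w' o' u x : semimetric d ->
  incr_row d (o, w, v, w', o', u, x) =
  \row_i [:: cross_ratio d o o' u v; cross_ratio d w w' u v;
             cross_ratio d o w u x; cross_ratio d w' o' u x]`_i.
Proof.
move=> sd; rewrite /incr_row /cross_ratio.
by rewrite (fdistC v o') // (fdistC v w').
Qed.

Lemma R_ME M d q : semimetrics M d -> regp7 q -> R_M M q = incr_row d q.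
Proof.
case: q => [[[[[[ o w] v] w'] o'] u] x] Md [uq _]; rewrite /R_M.
have Mg := xgetPex std_dist (semimetrics_neq0 M).
rewrite !incr_row_cross_ratio; try exact: semimetrics_semimetric Mg;
  try exact: semimetrics_semimetric Md.
have E := semimetrics_equiv Mg Md.
move: uq; rewrite /= !inE !negb_or => uq.
rewrite (E o o' u v) ?(E w w' u v) ?(E o w u x) ?(E w' o' u x) //.
all: do !(case/andP: uq => ? uq).
all: rewrite /= !inE !negb_or; do !(apply/andP; split=> //).
all: do !match goal with H : is_true (_ && _) |- _ => case/andP: H => ? ? end.
all: by rewrite // eq_sym.
Qed.

Definition is_metric d :=
  semimetric d /\ forall x y z, (d x z <= d x y + d y z)%E.

Definition metrics0 u : set (circle -> circle -> \bar R) :=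
  [set d | [/\ semimetrics mobius_structure0 d, is_metric d & remote d u]].

Definition eps_of d (q : septuple) : R :=
  let '(o, w, v, w', o', u, x) := q in
  fdist d o w ^+ 2 / (4 * fdist d x w' ^+ 2).

(* computed with an arbitrary metric in [metrics0 u], cf. [epsE] *)
Definition eps (q : septuple) : R :=
  let '(o, w, v, w', o', u, x) := q in eps_of (xget std_dist (metrics0 u)) q.

Definition inversion (u x : circle) : circle :=
  match u, x with
  | None, _ => x
  | Some a, Some b => if a == b then None else Some (b - a)^-1
  | Some a, None => Some 0
  end.

Lemma inversion_inj u : injective (inversion u).
Proof.
case: u => [a|//] [b|] [c|] //=.
- case: (eqVneq a b) => [<-|ab]; case: (eqVneq a c) => [<-|ac] //.
  by move=> [] /invr_inj /addIr ->.
- case: (eqVneq a b) => // ab [] /eqP.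
  by rewrite invr_eq0 subr_eq0 eq_sym (negPf ab).
- case: (eqVneq a c) => // ac [] /esym/eqP.
  by rewrite invr_eq0 subr_eq0 eq_sym (negPf ac).
Qed.

Definition inv_dist u : circle -> circle -> \bar R :=
  fun x y => std_dist (inversion u x) (inversion u y).

Lemma inversionu u : inversion u u = None.
Proof. by case: u => [a|] //=; rewrite eqxx. Qed.

Lemma inv_dist_remote u : remote (inv_dist u) u.
Proof.
move=> x xu; rewrite /inv_dist inversionu; apply: std_dist_remote => e.
by apply: xu; apply: (@inversion_inj u); rewrite e inversionu.
Qed.

Lemma inv_dist_metric u : is_metric (inv_dist u).
Proof.
have [C Z P I _] := std_dist_semimetric.
have None_u x : inversion u x = None -> x = u.
  by move=> e; apply: (@inversion_inj u); rewrite e inversionu.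
have remoteE w : remote (inv_dist u) w -> w = u.
  move=> rw; apply: contrapT => wu.
  have [z [zw zu]] : exists z, z <> w /\ z <> u.
    have inf (a b : circle) : exists z : circle, z <> a /\ z <> b.
      case: a b => [a|] [b|].
      + by exists None.
      + exists (Some (a + 1)); split=> // -[] /eqP.
        by rewrite -subr_eq0 addrAC subrr add0r oner_eq0.
      + exists (Some (b + 1)); split=> // -[] /eqP.
        by rewrite -subr_eq0 addrAC subrr add0r oner_eq0.
      + by exists (Some 0).
    exact: inf.
  have := rw z zw; rewrite /inv_dist.
  case E1 : (inversion u z) => [a|]; last by move/None_u: E1.
  by case E2 : (inversion u w) => [b|] //; move/None_u: E2.
split; last by move=> x y z; exact: std_dist_triangle.
split.
- by move=> x y; exact: C.
- by move=> x; exact: Z.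
- by move=> x y xy; apply: P => /inversion_inj.
- move=> x y; rewrite /inv_dist.
  case E1 : (inversion u x) => [a|].
    case E2 : (inversion u y) => [b|] // _.
    by right; rewrite (None_u _ E2); exact: inv_dist_remote.
  by left; rewrite (None_u _ E1); exact: inv_dist_remote.
- by move=> w w' /remoteE -> /remoteE ->.
Qed.

Lemma inv_dist_std u : exists s : circle -> R,
  (forall x, s x != 0) /\ forall x y, x <> y ->
    fdist (inv_dist u) x y = s x * s y * fdist std_dist x y.
Proof.
case: u => [a|]; last first.
  by exists (fun=> 1); split=> // x y _; rewrite !mul1r.
exists (fun x => if x is Some b then
   if a == b then 1 else `|b - a|^-1 else 1).
split=> [[b|]|].
- case: (eqVneq a b) => [_|ab]; first exact: oner_neq0.
  by rewrite invr_eq0 normr_eq0 subr_eq0 eq_sym.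
- exact: oner_neq0.
case=> [b|] [c|] //= bc; rewrite /fdist /inv_dist /=.
- have {}bc : b != c by apply/eqP => e; apply: bc; rewrite e.
  case: (eqVneq a b) => [ab|ab]; case: (eqVneq a c) => [ac|ac] /=.
  + by move: bc; rewrite -ab ac eqxx.
  + by rewrite mul1r -ab distrC mulVf // normr_eq0 subr_eq0.
  + by rewrite mulr1 -ac mulVf // normr_eq0 subr_eq0 eq_sym.
  + have b0 : b - a != 0 by rewrite subr_eq0 eq_sym.
    have c0 : c - a != 0 by rewrite subr_eq0 eq_sym.
    rewrite -!normfV -!normrM distrC; congr (`|_|).
    by field; rewrite b0 c0.
- case: (eqVneq a b) => [ab|ab] /=; first by rewrite !mulr1.
  by rewrite subr0 normfV !mulr1.
- case: (eqVneq a c) => [ac|ac] /=; first by rewrite !mulr1.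
  by rewrite sub0r normrN normfV mulr1 mul1r.
Qed.

Lemma metrics0_inv_dist u : metrics0 u (inv_dist u).
Proof.
have [md sd] := inv_dist_metric u.
split; [|by []|exact: inv_dist_remote].
split=> // x1 x2 x3 x4; rewrite /= !inE !negb_or => /and4P[].
move=> /and3P[/eqP x12 /eqP x13 /eqP x14] /andP[/eqP x23 /eqP x24] /eqP x34 _.
have [s [s0 sE]] := inv_dist_std u; rewrite /cross_ratio !sE //.
have p x y : x <> y -> fdist std_dist x y != 0.
  by move=> xy; rewrite gt_eqF // fdist_gt0 //; exact: std_dist_semimetric.
by field; rewrite !s0 !p.
Qed.

Lemma epsE d o w v w' o' u x :
    let q := (o, w, v, w', o', u, x) in
    semimetrics mobius_structure0 d -> remote d u -> regp7 q ->
  eps q = eps_of d q.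
Proof.
move=> q Md rd [uq _]; rewrite /eps /eps_of /=.
set g := xget _ _.
have [Mg _ rg] : metrics0 u g.
  by apply: xgetPex; exists (inv_dist u); exact: metrics0_inv_dist.
have E := semimetrics_equiv Mg Md.
have sg := semimetrics_semimetric Mg; have sd := semimetrics_semimetric Md.
move: uq; rewrite /= !inE !negb_or => uq.
do !match goal with H : is_true (_ && _) |- _ => case/andP: H => ? ? end.
do !match goal with H : is_true (_ != _) |- _ => move/eqP in H end.
have sy (y z : circle) : y <> z -> z <> y by move=> yz /esym.
have k1 : fdist g w o / fdist g w w' = fdist d w o / fdist d w w'.
  have := E u w w' o; rewrite /cross_ratio (fdistC u w') // (fdistC u o) //.
  rewrite (fdistC (d := d) u w') // (fdistC (d := d) u o) //.
  rewrite !(fdist_remote rg) ?(fdist_remote rd) //; try exact: sy.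
  rewrite !mul1r; apply.
  by rewrite /= !inE !negb_or; do !(apply/andP; split=> //); apply/eqP; auto.
have k2 : fdist g w' w / fdist g w' x = fdist d w' w / fdist d w' x.
  have := E u w' x w; rewrite /cross_ratio (fdistC u x) // (fdistC u w) //.
  rewrite (fdistC (d := d) u x) // (fdistC (d := d) u w) //.
  rewrite !(fdist_remote rg) ?(fdist_remote rd) //; try exact: sy.
  rewrite !mul1r; apply.
  by rewrite /= !inE !negb_or; do !(apply/andP; split=> //); apply/eqP; auto.
have k d1 : semimetric d1 -> fdist d1 o w ^+ 2 / (4 * fdist d1 x w' ^+ 2) =
    ((fdist d1 w o / fdist d1 w w') * (fdist d1 w' w / fdist d1 w' x)) ^+ 2 / 4.
  move=> sd1; rewrite (fdistC o w) // (fdistC x w') // (fdistC w' w) //.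
  have p1 : fdist d1 w w' != 0 by rewrite gt_eqF // fdist_gt0 //.
  have p2 : fdist d1 w' x != 0 by rewrite gt_eqF // fdist_gt0 //; auto.
  by field; rewrite p1 p2.
by rewrite !k // k1 k2.
Qed.

(* the library's norm `|r| on matrices is the sup norm *)
Definition euclidean_norm (r : 'rV[R]_4) : R := Num.sqrt (\sum_i r 0 i ^+ 2).

Definition V_eps : set (septuple * 'rV[R]_4) :=
  [set p | regp7 p.1 /\
     euclidean_norm (p.2 - R_M mobius_structure0 p.1) < eps p.1].

Definition U_ (V : set (septuple * 'rV[R]_4)) : set mobius_structure :=
  [set M | monotone_mobius M /\ forall q, regp7 q -> V (q, R_M M q)].

Definition increment_axiom M := forall q, regp7 q ->
  R_M M q 0 0 = 1 -> R_M M q 0 1 = 1 -> R_M M q 0 3 < R_M M q 0 2.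

End MobiusStructures.

(* Main.v *)
(** Take [u] as the point at infinity, so that [x, o, w, v, w', o'] lie on a line
    in this order, up to reflection.  Let [s = |ow| / |ox|], [t = |ow| / |xw'|], so
    that [eps q = t^2 / 4].  If the first two coordinates of [R_M q] are 1, then
    [|vo'|] is close to [|ov|] and [|vw'|] to [|wv|], hence
    [|w'o'| < |ow| + 2 eps |xw'|].  So the fourth coordinate for [M0] is less than
    [1 + t + 2 eps], while the third is [1 + s].  Since
    [s - t = s |ow'| / |xw'| > s t > t^2 = 4 eps], errors of [eps] in each of these
    two coordinates cannot reverse their order. *)

Require Import Defs.
From mathcomp Require Import all_boot all_order all_algebra.
From mathcomp Require Import all_classical all_reals all_analysis.
From mathcomp Require Import ring lra.

Set Implicit Arguments.
Unset Strict Implicit.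
Unset Printing Implicit Defensive.

Import Order.TTheory GRing.Theory Num.Theory.

Local Open Scope ring_scope.

Section IncrementAxiom.
Variable R : realType.

(** The variables are the coordinates of the six points other than [u], with [u] at infinity. The
    hypotheses say that [1], [1], [r3], [r4] differ from the entries of the canonical [R_M] by less
    than [e]. *)
Lemma increment_line (x o w v w' o' r3 r4 : R) :
    x < o -> o < w -> w < v -> v < w' -> w' < o' ->
    let e := (w - o) ^+ 2 / (4 * (w' - x) ^+ 2) in
    `|1 - (o' - v) / (v - o)| < e -> `|1 - (w' - v) / (v - w)| < e ->
    `|r3 - (w - x) / (o - x)| < e -> `|r4 - (o' - x) / (w' - x)| < e ->
  r4 < r3.
Proof.
move=> xo ow wv vw' w'o' e.
set s := (w - o) / (o - x); set t := (w - o) / (w' - x).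
have ox0 : 0 < o - x by lra.
have wx0 : 0 < w' - x by lra.
have vo0 : 0 < v - o by lra.
have vw0 : 0 < v - w by lra.
have t0 : 0 < t by rewrite divr_gt0 //; lra.
have eE : 4 * e = t ^+ 2 by rewrite /e /t; field; rewrite gt_eqF.
have tE : t * (w' - x) = w - o by rewrite divfK // gt_eqF.
have ts : t < s by rewrite ltr_pM2l ?ltf_pV2 ?posrE //; lra.
have st : t ^+ 2 < s - t.
  have -> : s - t = s * ((w' - o) / (w' - x)).
    by rewrite /s /t; field; rewrite !gt_eqF.
  have : t < (w' - o) / (w' - x) by rewrite ltr_pM2r ?invr_gt0 //; lra.
  by rewrite expr2 => h; apply: ltr_pM => //; exact: ltW.
rewrite !ltr_norml => /andP[h1 _] /andP[_ h2] /andP[h3 _] /andP[_ h4].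
have {}h1 : o' - v < (1 + e) * (v - o) by rewrite -ltr_pdivrMr //; lra.
have {}h2 : (1 - e) * (v - w) < w' - v by rewrite -ltr_pdivlMr //; lra.
have r3E : (w - x) / (o - x) = 1 + s by rewrite /s; field; rewrite gt_eqF.
have e0 : 0 < e by have := exprn_gt0 2 t0; lra.
(* [o' - w'] is less than [(1 + e) * (v - o) - (1 - e) * (v - w)], which equals
   [(w - o) + e * (v - o) + e * (v - w)]. *)
have r4E : (o' - x) / (w' - x) < 1 + t + 2 * e.
  rewrite ltr_pdivrMr // !mulrDl tE mul1r.
  have b1 : e * (v - o) < e * (w' - x) by rewrite ltr_pM2l //; lra.
  have b2 : e * (v - w) < e * (w' - x) by rewrite ltr_pM2l //; lra.
  lra.
(* Here [r3 > 1 + s - e] and [r4 < 1 + t + 3 * e], while [s - t > t ^+ 2 = 4 * e]. *)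
lra.
Qed.

Lemma ler_euclidean_norm (r : 'rV[R]_4) i : `|r 0 i| <= euclidean_norm r.
Proof.
rewrite /euclidean_norm -sqrtr_sqr ler_wsqrtr // (bigD1 i) //= lerDl.
by apply: sumr_ge0 => j _; exact: sqr_ge0.
Qed.

Definition cyclic3 (p q r : circle R) :=
  [|| cut_lt p q && cut_lt q r, cut_lt q r && cut_lt r p
    | cut_lt r p && cut_lt p q].

Lemma cut_lt_trans : transitive (@cut_lt R).
Proof. by move=> p q r; exact: lt_trans. Qed.

(** In the increasing rotation [D ++ u :: T], [T] lies above [u] and [D] below, so the way round
    from [u] meets [T] first and then [D]. *)
Lemma cyclically_ordered_cyclic3 (u : circle R) s n :
  cyclically_ordered (rot n (u :: s)) -> sorted (cyclic3 u) s.
Proof.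
case=> k; rewrite rot_rot_add sorted_pairwise; last exact: cut_lt_trans.
move: (rot_add _ _ _) => m.
have [T [D [-> ->]]] : exists T D, s = T ++ D /\ rot m (u :: s) = D ++ u :: T.
  case: m => [|m]; first by exists s, [::]; rewrite cats0 rot0.
  by exists (take m s), (drop m s); rewrite cat_take_drop.
rewrite pairwise_cat allrel_consr pairwise_cons -andbA.
case/and5P=> Du DT pD uT pT; apply: pairwise_sorted; rewrite pairwise_cat.
apply/and3P; split.
- apply/allrelP => p q pT' qD; rewrite /cyclic3.
  by rewrite (allP uT _ pT') (allP Du _ qD) !orbT.
- apply: sub_in_pairwise uT pT => p q up uq pq.
  by rewrite /cyclic3 pq (up : cut_lt u p).
- apply: sub_in_pairwise Du pD => p q pu qu pq.
  by rewrite /cyclic3 pq (qu : cut_lt q u) orbT.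
Qed.

(* [inversion (Some a)] reverses the orientation of the circle, whence the sign. *)
Definition coord (u p : circle R) : R :=
  let r := if inversion u p is Some r then r else 0 in
  if u is Some _ then - r else r.

(** For [u = Some a] the coordinate [-1 / (p - a)] rises through negative values for [p > a], is 0
    at infinity, and rises through positive values for [p < a]. *)
Lemma coord_cyclic3 u p q : cyclic3 u p q -> coord u p < coord u q.
Proof.
rewrite /cyclic3 /coord /cut_lt.
case: u p q => [a|] [b|] [c|] //=;
  rewrite ?(ltNge +oo%E) ?leey ?ltry ?lte_fin ?andbF ?andbT ?orbF //=.
- move=> abc; have [ab ac] : a != b /\ a != c.
    by case/or3P: abc => /andP[? ?]; split; apply/eqP; lra.
  rewrite (negPf ab) (negPf ac) ltrN2.
  case/or3P: abc => /andP[h1 h2].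
  + by rewrite ltf_pV2 ?posrE; lra.
  + by rewrite ltf_nV2 ?negrE; lra.
  + by apply: (@lt_trans _ _ 0); rewrite ?invr_lt0 ?invr_gt0; lra.
- by move=> ab; rewrite lt_eqF // ltrN2 invr_gt0 subr_gt0.
- by move=> ca; rewrite gt_eqF // oppr0 oppr_gt0 invr_lt0 subr_lt0.
Qed.

Lemma fdist_inv_dist u p q : p <> u -> q <> u ->
  fdist (inv_dist u) p q = `|coord u p - coord u q|.
Proof.
have pu z : z <> u -> inversion u z <> None.
  by move=> zu; rewrite -(inversionu u) => /inversion_inj.
move=> /pu + /pu; rewrite /fdist /inv_dist /coord.
case: (inversion u p) => [b|] // _; case: (inversion u q) => [c|] // _ /=.
by case: u {pu} => [a|] //; rewrite -opprD normrN.
Qed.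

End IncrementAxiom.

Theorem proposition7p14 (R : realType) (M : mobius_structure R) :
  U_ (@V_eps R) M -> increment_axiom M.
Proof.
move=> [_ V_M] [[[[[[ o w] v] w'] o'] u] x] q_reg.
have [_] := V_M _ q_reg; rewrite [(_, _).1]/= [(_, _).2]/=.
(* Both [eps] and the canonical [R_M] may be computed in one metric with [u] infinitely remote. *)
have [m0 _ rem_u] := metrics0_inv_dist u.
have sd := semimetrics_semimetric m0.
rewrite (epsE m0 rem_u q_reg) (R_ME m0 q_reg).
set r := R_M M _; set r0 := incr_row _ _ => r_near r00 r01.
have {r_near} near i :
    `|r 0 i - r0 0 i| < eps_of (inv_dist u) (o, w, v, w', o', u, x).
  apply: le_lt_trans r_near.
  by have := ler_euclidean_norm (r - r0) i; rewrite !mxE.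
have [uq ord] := q_reg.
(* The orientation of the septuple decides the sign of [f]. *)
have [f [f_sorted fE]] : exists f : circle R -> R,
    sorted <%R (map f [:: x; o; w; v; w'; o']) /\
    forall p p', p <> u -> p' <> u -> fdist (inv_dist u) p p' = `|f p - f p'|.
  case: ord => ord.
  - exists (coord u); split; last exact: fdist_inv_dist.
    apply: (homo_sorted (e := cyclic3 u)); first exact: coord_cyclic3.
    (* The septuple is [rot 2] of a list headed by [u]; its reverse, below, is [rot 6] of one. *)
    exact: (cyclically_ordered_cyclic3 (n := 2)).
  - exists (\- coord u); split=> [|p p' pu p'u]; last first.
      by rewrite fdist_inv_dist //= -opprD normrN.
    rewrite -rev_sorted -map_rev.
    apply: (homo_sorted (e := cyclic3 u)) => [p p' /coord_cyclic3|].
      by rewrite -[X in _ -> is_true X]/(- coord u p' < - coord u p) ltrN2.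
    exact: (cyclically_ordered_cyclic3 (n := 6)).
have [ou wu vu [w'u o'u xu]] :
    [/\ o <> u, w <> u, v <> u & [/\ w' <> u, o' <> u & x <> u]].
  have uN p : p \in [:: x; o; w; v; w'; o'] -> p <> u.
    have : uniq [:: u; x; o; w; v; w'; o'] by rewrite -(rot_uniq 2).
    by case/andP=> uN _ p_in pu; rewrite -pu p_in in uN.
  by split; [| | |split]; apply: uN; rewrite !inE eqxx ?orbT.
move: f_sorted => /= /and5P[xo ow wv vw' /andP[w'o' _]].
have fd_lt p p' : p <> u -> p' <> u -> f p < f p' ->
    fdist (inv_dist u) p p' = f p' - f p.
  by move=> pu p'u pp'; rewrite fE // distrC gtr0_norm // subr_gt0.
have fd_gt p p' : p <> u -> p' <> u -> f p' < f p ->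
    fdist (inv_dist u) p p' = f p - f p'.
  by move=> pu p'u pp'; rewrite fdistC // fd_lt.
have fdu p : p <> u -> fdist (inv_dist u) p u = 1.
  by move=> pu; rewrite fdist_remote.
have xw := lt_trans xo ow; have ov := lt_trans ow wv.
have ww' := lt_trans wv vw'; have vo' := lt_trans vw' w'o'.
have xw' := lt_trans xw ww'; have xo' := lt_trans xw' w'o'.
move: (near 0) (near 1) (near 2) (near 3).
rewrite r00 r01 !mxE /eps_of /= !fdu // !mulr1 !mul1r.
rewrite (fd_lt v o') // (fd_lt o v) // (fd_lt v w') // (fd_lt w v) //.
rewrite (fd_gt w x) // (fd_gt o x) // (fd_gt o' x) // (fd_gt w' x) //.
rewrite (fd_lt o w) // (fd_lt x w') //.
exact: increment_line.
Qed.
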